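(* Let $S$ be a nonempty set and let $G$ be a group of permutations of $S$. The twisted Brin–Thompson group $SV_G$ is finitely generated if and only if $G$ is finitely generated and the action of $G$ on $S$ has finitely many orbits.
   Context: Let $\mathfrak C=\{0,1\}^{\omega}$ be the Cantor set, $S$ a nonempty set, and $G$ a subgroup of the symmetric group of $S$ (so $G$ acts faithfully on $S$). Let $\mathfrak C^S$ be the space of all functions $S\to\mathfrak C$ with the product topology. For a function $\psi\colon S\to\{0,1\}^*$ (finite binary words, $\varnothing$ the empty word) with $\psi(s)=\varnothing$ for all but finitely many $s$, the dyadic brick $B(\psi)$ is the set of $\kappa\in\mathfrak C^S$ such that $\psi(s)$ is a prefix of $\kappa(s)$ for all $s\in S$; the canonical homeomorphism $\Phi_\psi\colon\mathfrak C^S\to B(\psi)$ is $\Phi_\psi(\kappa)(s)=\psi(s)\cdot\kappa(s)$ (concatenation). For $\gamma\in G$ let $\tau_\gamma\colon\mathfrak C^S\to\mathfrak C^S$ be $\tau_\gamma(\kappa)(s)=\kappa(\gamma^{-1}s)$. The twist homeomorphism $B(\varphi)\to B(\psi)$ associated to $\gamma$ is $\Phi_\psi\circ\tau_\gamma\circ\Phi_\varphi^{-1}$. The twisted Brin–Thompson group $SV_G$ is the group of all homeomorphisms $h$ of $\mathfrak C^S$ for which there exist two partitions $B(\varphi_1),\dots,B(\varphi_n)$ and $B(\psi_1),\dots,B(\psi_n)$ of $\mathfrak C^S$ into dyadic bricks and elements $\gamma_1,\dots,\gamma_n\in G$ such that $h$ restricted to $B(\varphi_i)$ is the twist homeomorphism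 $B(\varphi_i)\to B(\psi_i)$ associated to $\gamma_i$, for each $i$. *)

(* Defs.v *)
From Stdlib Require Import List Arith.
Import ListNotations.
Set Implicit Arguments.

Definition Cantor := nat -> bool.
Definition CS (S : Type) := S -> Cantor.

Definition is_bij {X : Type} (f : X -> X) : Prop :=
  exists g : X -> X, (forall x, g (f x) = x) /\ (forall x, f (g x) = x).

Definition is_perm_subgroup {S : Type} (G : (S -> S) -> Prop) : Prop :=
  (forall g, G g -> is_bij g) /\
  G (fun s => s) /\
  (forall g h, G g -> G h -> G (fun s => g (h s))) /\
  (forall g gi, G g -> (forall s, gi (g s) = s) -> (forall s, g (gi s) = s) -> G gi).

Inductive gen {X : Type} (L : list (X -> X)) : (X -> X) -> Prop :=
| gen_id : gen L (fun x => x)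
| gen_mul : forall g h, In g L -> gen L h -> gen L (fun x => g (h x))
| gen_mulinv : forall g gi h, In g L ->
    (forall x, gi (g x) = x) -> (forall x, g (gi x) = x) ->
    gen L h -> gen L (fun x => gi (h x))
| gen_ext : forall h h', gen L h -> (forall x, h x = h' x) -> gen L h'.

Definition fin_gen {X : Type} (H : (X -> X) -> Prop) : Prop :=
  exists L : list (X -> X), (forall g, In g L -> H g) /\ (forall h, H h -> gen L h).

Definition finitely_many_orbits {S : Type} (G : (S -> S) -> Prop) : Prop :=
  exists reps : list S, forall s, exists r g, In r reps /\ G g /\ g r = s.

(** Product topology on C^S = {0,1}^(S x omega): continuity of maps C^S -> C^S. *)
Definition continuous_CS {S : Type} (f : CS S -> CS S) : Prop :=
  forall (k : CS S) (s : S) (n : nat),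
    exists F : list (S * nat),
      forall k' : CS S, (forall t m, In (t, m) F -> k' t m = k t m) ->
        f k' s n = f k s n.

Definition homeo_CS {S : Type} (f : CS S -> CS S) : Prop :=
  continuous_CS f /\
  exists g : CS S -> CS S, continuous_CS g /\
    (forall k, g (f k) = k) /\ (forall k, f (g k) = k).

Definition prefix (w : list bool) (c : Cantor) : Prop :=
  forall i, i < length w -> nth i w false = c i.

Definition concat (w : list bool) (c : Cantor) : Cantor :=
  fun n => if n <? length w then nth n w false else c (n - length w).

Definition fin_support {S : Type} (psi : S -> list bool) : Prop :=
  exists F : list S, forall s, psi s <> [] -> In s F.

Definition in_brick {S : Type} (psi : S -> list bool) (k : CS S) : Prop :=
  forall s, prefix (psi s) (k s).

Definition Phi {S : Type} (psi : S -> list bool) (k : CS S) : CS S :=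
  fun s => concat (psi s) (k s).

(** tau_gamma(k)(s) = k(gamma^{-1} s); gammai is the inverse of gamma. *)
Definition tau {S : Type} (gammai : S -> S) (k : CS S) : CS S :=
  fun s => k (gammai s).

Definition brick_partition {S : Type} (n : nat) (phi : nat -> S -> list bool) : Prop :=
  (forall i, i < n -> fin_support (phi i)) /\
  (forall k : CS S, exists i, i < n /\ in_brick (phi i) k) /\
  (forall i j (k : CS S), i < n -> j < n -> in_brick (phi i) k -> in_brick (phi j) k -> i = j).

Definition SV {S : Type} (G : (S -> S) -> Prop) (h : CS S -> CS S) : Prop :=
  homeo_CS h /\
  exists (n : nat) (phi psi : nat -> S -> list bool) (gamma gammai : nat -> S -> S),
    brick_partition n phi /\ brick_partition n psi /\
    forall i, i < n ->
      G (gamma i) /\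
      (forall s, gammai i (gamma i s) = s) /\ (forall s, gamma i (gammai i s) = s) /\
      (* h restricted to B(phi i) is Phi_{psi i} o tau_{gamma i} o Phi_{phi i}^{-1} *)
      (forall k : CS S, h (Phi (phi i) k) = Phi (psi i) (tau (gammai i) k)).

(* Main.v *)
(** Write [S] for the index set, fix [s0 : S], and let [1^n, 1^(n-1)0, ..., 10, 0]
    be the comb partition of the Cantor cube into [n+1] bricks at [s0].

    Sufficiency.  Any brick partition can be turned into the trivial one by
    halving bricks and undoing halvings (halve all bricks that do not yet
    constrain a given coordinate, then treat the two halves separately).  Hence
    the comb of size [n+1] can be mapped onto any ordered partition using
    permutations of comb bricks and, on the deepest brick [1^n], the baker maps
    [baker s0 t] exchanging the first bit at [s0] for a first bit at [t]; an
    element of [SV_G] is a quotient of two such maps, up to twists on the comb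
    bricks.  All of this is generated by maps [f] and their copies
    [extend s0 f] on the half brick [1], because the element [grow] of Thompson's
    group conjugates a copy on [1^n] to the copy on [1^(n+1)].  Finitely many [f]
    suffice: two bit swaps, generators of [G], and finitely many baker maps, by
    the cocycle rule
    [baker s0 (g t) = tau_g o baker s0 t o tau_g^-1 o baker s0 (g s0)].

    Necessity.  Near each point, an element of [SV_G] changes finite prefixes and
    permutes the tails by an element of [G].  For words in a finite generating
    set, this permutation is a word in the finitely many permutations used by the
    generators, and prefixes change only on the [G]-orbits of the finitely many
    coordinates that the generators' bricks constrain.  Applied to [tau_g] this
    gives generators of [G]; applied to a bit flip at [s] it puts [s] in one of
    those orbits. *)

From Stdlib Require Import List Arith Lia Permutation.
From Stdlib Require Import FunctionalExtensionality ClassicalEpsilon.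
From Corelib Require Import ssreflect.
Require Import Defs.
Import ListNotations.
Set Implicit Arguments.
Local Open Scope general_if_scope.

(** * Two-sided inverses and words in generators *)

Definition cancels {X : Type} (f g : X -> X) : Prop :=
  (forall x, g (f x) = x) /\ (forall x, f (g x) = x).

Lemma cancels_sym {X : Type} (f g : X -> X) : cancels f g -> cancels g f.
Proof. by case. Qed.

Lemma cancels_comp {X : Type} (f g f' g' : X -> X) :
  cancels f g -> cancels f' g' ->
  cancels (fun x => f (f' x)) (fun x => g' (g x)).
Proof.
  move=> [fg gf] [fg' gf']; split=> x.
  - by rewrite fg fg'.
  - by rewrite gf' gf.
Qed.

Lemma cancels_unique {X : Type} (f g g' : X -> X) :
  cancels f g -> cancels f g' -> forall x, g x = g' x.
Proof. by move=> [_ fg] [gf' _] x; rewrite -{2}(fg x) gf'. Qed.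

Lemma gen_in {X : Type} (L : list (X -> X)) f : In f L -> gen L f.
Proof. by move=> Lf; apply: (gen_mul _ Lf (gen_id L)). Qed.

Lemma gen_comp {X : Type} (L : list (X -> X)) f g :
  gen L f -> gen L g -> gen L (fun x => f (g x)).
Proof.
  move=> Lf Lg; elim: Lf => {f} [|f h Lf _ IH|f fi h Lf fK fK' _ IH|h h' _ IH hh'].
  - exact: Lg.
  - exact: (gen_mul _ Lf IH).
  - exact: (gen_mulinv _ _ Lf fK fK' IH).
  - by apply: (gen_ext _ IH) => x; rewrite hh'.
Qed.

Lemma gen_hxsinverse {X : Type} (L : list (X -> X)) f :
  (forall g, In g L -> is_bij g) -> gen L f -> exists fi, gen L fi /\ cancels f fi.
Proof.
  move=> Lbij Lf.
  elim: Lf => {f} [|g h Lg Lh [hi [Lhi hK]]|g gi h Lg gK gK' Lh [hi [Lhi hK]]|h h' Lh [hi [Lhi [hK hK']]] hh'].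
  - by exists (fun x => x); split; first exact: gen_id.
  - have [gi gK] := Lbij g Lg.
    exists (fun x => hi (gi x)); split; last exact: (cancels_comp gK hK).
    apply: gen_comp => //; apply: (gen_ext _ (gen_mulinv _ gi Lg _ _ (gen_id L))) => //.
    + by case: gK.
    + by case: gK.
  - exists (fun x => hi (g x)); split.
    + by apply: gen_comp => //; apply: gen_in.
    + by apply: (@cancels_comp _ gi g h hi).
  - exists hi; split=> //; split=> x; by rewrite -hh'.
Qed.

Lemma gen_inv {X : Type} (L : list (X -> X)) f fi :
  (forall g, In g L -> is_bij g) -> gen L f -> cancels f fi -> gen L fi.
Proof.
  move=> Lbij Lf fK; have [fj [Lfj fjK]] := gen_hxsinverse Lbij Lf.
  by apply: (gen_ext _ Lfj); apply: (cancels_unique fjK fK).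
Qed.

(** Equality is decided classically because the index set is an arbitrary type. *)
Definition eqS {T : Type} (s t : T) : {s = t} + {s <> t} :=
  excluded_middle_informative (s = t).

(** * Brick partitions *)

Section Coordinates.
Context {T : Type}.
Implicit Types (s t : T) (b : bool) (k : CS T) (q : T -> list bool).

(** The canonical homeomorphism onto the half of the cube whose first bit at [s] is [b]; [tail_at s]
    forgets that bit. *)
Definition cons_at b s k : CS T :=
  fun t => if eqS t s then fun n => match n with 0 => b | S m => k t m end
           else k t.

Definition tail_at s k : CS T :=
  fun t => if eqS t s then fun n => k t (S n) else k t.

Lemma cs_ext k k' : (forall s n, k s n = k' s n) -> k = k'.
Proof.
  move=> kk'; apply: functional_extensionality => s.
  by apply: functional_extensionality => n.
Qed.

Lemma cons_at_head b s k : cons_at b s k s 0 = b.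
Proof. by rewrite /cons_at; case: eqS. Qed.

Lemma cons_atK b s k : tail_at s (cons_at b s k) = k.
Proof. by apply: cs_ext => t n; rewrite /tail_at /cons_at; case: eqS. Qed.

Lemma tail_atK s k : cons_at (k s 0) s (tail_at s k) = k.
Proof.
  apply: cs_ext => t n; rewrite /tail_at /cons_at; case: eqS => [->|] //.
  by case: n.
Qed.

Lemma cons_at_other b s k t : t <> s -> cons_at b s k t = k t.
Proof. by move=> ts; rewrite /cons_at; case: eqS. Qed.

(** Case analysis on the first bit at [s]: maps defined brick by brick are then computed by
    rewriting. *)
Lemma cons_at_ind s (P : CS T -> Prop) :
  (forall b k, P (cons_at b s k)) -> forall k, P k.
Proof. by move=> Pcons k; rewrite -(tail_atK s k). Qed.

Lemma tau_cons_at (g gi : T -> T) b s k : cancels g gi ->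
  tau gi (cons_at b s k) = cons_at b (g s) (tau gi k).
Proof.
  move=> [gK gK']; apply: cs_ext => t n; rewrite /tau /cons_at.
  case: (eqS (gi t) s) => [<-|ts]; first by rewrite gK'; case: eqS.
  by case: eqS => // tg; case: ts; rewrite tg gK.
Qed.

Lemma tau_cancels (g gi : T -> T) : cancels g gi -> cancels (@tau T gi) (tau g).
Proof.
  by move=> [gK gK']; split=> k; apply: cs_ext => s n; rewrite /tau ?gK ?gK'.
Qed.

Definition empty_brick : T -> list bool := fun _ => [].

Definition pre b s q : T -> list bool :=
  fun t => if eqS t s then b :: q t else q t.

Definition tl_at s q : T -> list bool :=
  fun t => if eqS t s then tl (q t) else q t.

Lemma Phi_empty k : Phi empty_brick k = k.
Proof.
  by apply: cs_ext => s n; rewrite /Phi /concat /= Nat.sub_0_r.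
Qed.

Lemma concat_cons b w c n :
  concat (b :: w) c n = match n with 0 => b | S m => concat w c m end.
Proof. by case: n. Qed.

Lemma Phi_pre b s q k : Phi (pre b s q) k = cons_at b s (Phi q k).
Proof.
  apply: cs_ext => t n; rewrite /Phi /pre /cons_at; case: eqS => // _.
  by rewrite concat_cons.
Qed.

Lemma Phi_cons_at b s q k : q s = [] ->
  Phi q (cons_at b s k) = cons_at b s (Phi q k).
Proof.
  move=> qs; apply: cs_ext => t n; rewrite /Phi /cons_at; case: eqS => // ->.
  by rewrite qs /concat /= !Nat.sub_0_r; case: n => //= n; rewrite Nat.sub_0_r.
Qed.

Lemma pre_tl_at b s q : hd_error (q s) = Some b -> pre b s (tl_at s q) = q.
Proof.
  move=> qs; apply: functional_extensionality => t; rewrite /pre /tl_at.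
  by case: eqS => // ->; case: (q s) qs => //= c w [->].
Qed.

Lemma Phi_of_in_brick q k : in_brick q k ->
  k = Phi q (fun s n => k s (length (q s) + n)).
Proof.
  move=> qk; apply: cs_ext => s n; rewrite /Phi /concat.
  case: Nat.ltb_spec => nq; first by rewrite -qk.
  by congr (k s _); lia.
Qed.

Lemma in_empty k : in_brick empty_brick k.
Proof. by move=> s i /=; lia. Qed.

Lemma in_pre b s q k :
  in_brick (pre b s q) k <-> k s 0 = b /\ in_brick q (tail_at s k).
Proof.
  split.
  - move=> qk; split.
      have := qk s 0; rewrite /pre; case: eqS => //= _ -> //; lia.
    move=> t i iq; have := qk t; rewrite /pre /tail_at.
    case: eqS => [ts|ts] qt; last exact: qt.
    by have := qt (S i) => /= <- //; lia.
  - move=> [kb qk] t i; have := qk t; rewrite /pre /tail_at.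
    case: eqS => [->|ts] qt iq; last exact: qt.
    case: i iq => [//|i] /= iq; apply: qt; lia.
Qed.

Lemma fin_support_empty : fin_support empty_brick.
Proof. by exists []. Qed.

Lemma fin_support_pre b s q : fin_support q -> fin_support (pre b s q).
Proof.
  move=> [F qF]; exists (s :: F) => t; rewrite /pre.
  by case: eqS => [->|_ /qF]; [left|right].
Qed.

Definition indicator q k : nat :=
  if excluded_middle_informative (in_brick q k) then 1 else 0.

(** A list of bricks is a partition exactly when this count is constantly 1: one additive equation,
    blind to order, replaces covering and disjointness. *)
Definition multiplicity (Q : list (T -> list bool)) k : nat :=
  list_sum (map (fun q => indicator q k) Q).

Lemma indicator_empty k : indicator empty_brick k = 1.
Proof.
  rewrite /indicator; case: excluded_middle_informative => // H.
  by case: H; apply: in_empty.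
Qed.

Lemma indicator_pre b s q k :
  indicator (pre b s q) k =
  if Bool.eqb (k s 0) b then indicator q (tail_at s k) else 0.
Proof.
  rewrite /indicator; case: excluded_middle_informative => [/in_pre [-> qk]|nqk].
    by rewrite Bool.eqb_reflx; case: excluded_middle_informative.
  case E : Bool.eqb => //; case: excluded_middle_informative => // qk.
  by case: nqk; apply/in_pre; split=> //; apply: Bool.eqb_prop.
Qed.

Lemma multiplicity_cons q Q k :
  multiplicity (q :: Q) k = indicator q k + multiplicity Q k.
Proof. by []. Qed.

Lemma multiplicity_app Q Q' k :
  multiplicity (Q ++ Q') k = multiplicity Q k + multiplicity Q' k.
Proof. by rewrite /multiplicity map_app list_sum_app. Qed.

Lemma multiplicity_pos Q k : 0 < multiplicity Q k -> exists2 q, In q Q & in_brick q k.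
Proof.
  elim: Q => [|q Q IH]; first by rewrite /multiplicity /=; lia.
  rewrite multiplicity_cons /indicator; case: excluded_middle_informative => [qk _|_ /IH [q' Qq' q'k]].
  - by exists q => //; left.
  - by exists q' => //; right.
Qed.

Lemma multiplicity_in Q k q : In q Q -> in_brick q k -> 0 < multiplicity Q k.
Proof.
  elim: Q => [//|q' Q IH] /= Qq qk; rewrite multiplicity_cons.
  case: Qq => [->|Qq]; last by have := IH Qq qk; lia.
  rewrite /indicator; case: excluded_middle_informative => //; lia.
Qed.

Lemma brick_partition_of_list Q :
  (forall q, In q Q -> fin_support q) -> (forall k, multiplicity Q k = 1) ->
  brick_partition (length Q) (fun i => nth i Q empty_brick).
Proof.
  move=> Qfin Q1; split; [|split].
  - by move=> i iQ; apply: Qfin; apply: nth_In.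
  - move=> k; have [|q Qq qk] := @multiplicity_pos Q k; first by rewrite Q1; lia.
    have [i [iQ qi]] := In_nth Q q empty_brick Qq.
    by exists i; rewrite qi.
  (* Only the upper bound is kept, since it passes to the tail of the list; two distinct indices
     would count [k] twice. *)
  - move=> i j k; have : multiplicity Q k <= 1 by rewrite Q1.
    elim: Q {Qfin Q1} i j => [|q Q IH] i j /=; first by lia.
    rewrite multiplicity_cons => H.
    case: i j => [|i] [|j] //= iQ jQ ik jk.
    + have := @multiplicity_in Q k _ (nth_In Q empty_brick (proj2 (Nat.succ_lt_mono _ _) jQ)) jk.
      move: H; rewrite /indicator; case: excluded_middle_informative => //; lia.
    + have := @multiplicity_in Q k _ (nth_In Q empty_brick (proj2 (Nat.succ_lt_mono _ _) iQ)) ik.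
      move: H; rewrite /indicator; case: excluded_middle_informative => //; lia.
    + by congr S; apply: IH => //; lia.
Qed.

Lemma multiplicity_of_partition n (phi : nat -> T -> list bool) k :
  brick_partition n phi -> multiplicity (map phi (seq 0 n)) k = 1.
Proof.
  move=> [_ [cov disj]].
  have [i [iltn ik]] := cov k.
  have jn : forall j, In j (seq 0 n) -> j < n by move=> j /in_seq; lia.
  have : In i (seq 0 n) by apply/in_seq; lia.
  (* Induction over a duplicate-free list of indices containing [i]: the entry [i] contributes 1 and
     disjointness makes every other entry contribute 0. *)
  elim: (seq 0 n) (seq_NoDup n 0) jn => [//|j l IH] nd jn.
  have [nj ndl] : ~ In j l /\ NoDup l by inversion nd.
  rewrite /= multiplicity_cons => -[ji|il].
  - subst j.
    have -> : indicator (phi i) k = 1.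
      by rewrite /indicator; case: excluded_middle_informative.
    suff : ~ 0 < multiplicity (map phi l) k by lia.
    move=> /multiplicity_pos [q /in_map_iff [j [<- lj]] jk].
    apply: nj; rewrite (disj i j k) //; apply: jn; by right.
  - rewrite IH //; first by move=> j' lj'; apply: jn; right.
    rewrite /indicator; case: excluded_middle_informative => // jk.
    case: nj; rewrite (disj j i k) //; apply: jn; by left.
Qed.

End Coordinates.

(** * Elements presented by twists *)

Section Twists.
Context {T : Type}.
Implicit Types (s t : T) (b : bool) (k : CS T) (q : T -> list bool).
Variable G : (T -> T) -> Prop.
Hypothesis Ggrp : is_perm_subgroup G.

Record twist := Twist {
  dom : T -> list bool;
  cod : T -> list bool;
  twp : T -> T;
  twpi : T -> T }.

Definition acts_by (f : CS T -> CS T) (a : twist) : Prop :=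
  forall k, f (Phi (dom a) k) = Phi (cod a) (tau (twpi a) k).

Definition valid_twist (f : CS T -> CS T) (a : twist) : Prop :=
  fin_support (dom a) /\ fin_support (cod a) /\
  G (twp a) /\ cancels (twp a) (twpi a) /\ acts_by f a.

Definition presents (f : CS T -> CS T) (l : list twist) : Prop :=
  (forall a, In a l -> valid_twist f a) /\
  (forall k, multiplicity (map dom l) k = 1) /\
  (forall k, multiplicity (map cod l) k = 1).

Lemma presents_dom f l k : presents f l ->
  exists2 a, In a l & in_brick (dom a) k.
Proof.
  move=> [_ [dom1 _]].
  have [|q /in_map_iff [a [<- la]] ak] := @multiplicity_pos _ (map dom l) k.
    by rewrite dom1; lia.
  by exists a.
Qed.

Definition twist_inv (a : twist) : twist :=
  Twist (cod a) (dom a) (twpi a) (twp a).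

Lemma presents_inverse f g l : presents f l -> cancels f g ->
  presents g (map twist_inv l).
Proof.
  move=> [lf [dom1 cod1]] fg; split; [|split].
  - move=> _ /in_map_iff [a [<- /lf [fd [fc [Ga [aK af]]]]]].
    case: (Ggrp) => [_ [_ [_ Ginv]]].
    split=> //; split=> //; split; last split.
    + by apply: (Ginv _ _ Ga); case: aK.
    + exact: cancels_sym.
    + move=> k /=; rewrite -[RHS](proj1 fg) af; congr g; congr Phi.
      by case: (tau_cancels aK) => _ ->.
  - by move=> k; rewrite map_map.
  - by move=> k; rewrite map_map.
Qed.

Lemma presents_continuous f l : presents f l -> continuous_CS f.
Proof.
  move=> lf k s n; have [a la ak] := presents_dom k lf.
  have [[F aF] [_ [_ [_ af]]]] := proj1 lf a la.
  (* The first entry is the bit copied to position [n] at [s] when [n] lies beyond the new prefix;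
     the others certify membership in the source brick. *)
  exists ((twpi a s, length (dom a (twpi a s)) + (n - length (cod a s))) ::
    flat_map (fun t => map (pair t) (seq 0 (length (dom a t)))) F) => k' kk'.
  have ak' : in_brick (dom a) k'.
    move=> t i it; rewrite (kk' t i); last exact: ak.
    right; apply/in_flat_map; exists t; split.
      by apply: aF => at0; move: it; rewrite at0 /=; lia.
    by apply/in_map_iff; exists i; split=> //; apply/in_seq; lia.
  rewrite (Phi_of_in_brick ak) (Phi_of_in_brick ak') !af /Phi /concat /tau.
  by case: Nat.ltb_spec => // _; rewrite kk' //; left.
Qed.

Lemma SV_of_presents f g l : presents f l -> cancels f g -> SV G f.
Proof.
  move=> lf fg; have lg := presents_inverse lf fg.
  have fc := presents_continuous lf.
  split.
    by split=> //; exists g; split; [exact: (presents_continuous lg)|].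
  have [lv [dom1 cod1]] := lf.
  (* The default twist has empty words, so that [map_nth] matches the default [empty_brick] of
     [brick_partition_of_list]. *)
  pose d := Twist (fun _ : T => []) (fun _ => []) (fun x => x) (fun x => x).
  have := @brick_partition_of_list _ (map dom l) _ dom1.
  have := @brick_partition_of_list _ (map cod l) _ cod1.
  rewrite !length_map => cp dp.
  exists (length l), (fun i => dom (nth i l d)), (fun i => cod (nth i l d)),
    (fun i => twp (nth i l d)), (fun i => twpi (nth i l d)); split; [|split].
  - suff -> : (fun i => dom (nth i l d)) = (fun i => nth i (map dom l) empty_brick).
      by apply: dp => q /in_map_iff [a [<- /lv]]; case.
    by apply: functional_extensionality => i; rewrite -(map_nth dom).
  - suff -> : (fun i => cod (nth i l d)) = (fun i => nth i (map cod l) empty_brick).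
      by apply: cp => q /in_map_iff [a [<- /lv]]; case=> _; case.
    by apply: functional_extensionality => i; rewrite -(map_nth cod).
  - move=> i il; have [_ [_ [Gi [[iK iK'] ai]]]] := lv _ (nth_In l d il).
    by split.
Qed.

Lemma presents_of_SV f : SV G f -> exists l, presents f l.
Proof.
  move=> [_ [n [phi [psi [g [gi [Pphi [Ppsi H]]]]]]]].
  exists (map (fun i => Twist (phi i) (psi i) (g i) (gi i)) (seq 0 n)).
  split; [|split].
  - move=> _ /in_map_iff [i [<- /in_seq iln]].
    have iltn : i < n by lia.
    have [Gi [iK [iK' ai]]] := H i iltn.
    split; first by case: Pphi => [+ _]; apply.
    split; first by case: Ppsi => [+ _]; apply.
    by split=> //; split.
  - by move=> k; rewrite map_map; apply: multiplicity_of_partition.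
  - by move=> k; rewrite map_map; apply: multiplicity_of_partition.
Qed.

Lemma multiplicity_pre b s Q k :
  multiplicity (map (pre b s) Q) k =
  if Bool.eqb (k s 0) b then multiplicity Q (tail_at s k) else 0.
Proof.
  elim: Q => [|q Q IH] /=; first by case: Bool.eqb.
  by rewrite !multiplicity_cons IH indicator_pre; case: Bool.eqb.
Qed.

Definition extend s (f : CS T -> CS T) : CS T -> CS T :=
  fun k => if k s 0 then cons_at true s (f (tail_at s k)) else k.

Lemma extend_true s f k :
  extend s f (cons_at true s k) = cons_at true s (f k).
Proof. by rewrite /extend cons_at_head cons_atK. Qed.

Lemma extend_false s f k :
  extend s f (cons_at false s k) = cons_at false s k.
Proof. by rewrite /extend cons_at_head. Qed.

Lemma extend_comp s f g :
  extend s (fun k => f (g k)) = (fun k => extend s f (extend s g k)).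
Proof.
  apply: functional_extensionality => k; elim/(@cons_at_ind _ s): k => -[] k.
  - by rewrite !extend_true.
  - by rewrite !extend_false.
Qed.

Lemma extend_id s : extend s (fun k => k) = fun k => k.
Proof.
  apply: functional_extensionality => k; elim/(@cons_at_ind _ s): k => -[] k.
  - by rewrite extend_true.
  - by rewrite extend_false.
Qed.

Lemma extend_cancels s f g : cancels f g -> cancels (extend s f) (extend s g).
Proof.
  move=> [fg gf]; split=> k; elim/(@cons_at_ind _ s): k => -[] k.
  - by rewrite !extend_true fg.
  - by rewrite !extend_false.
  - by rewrite !extend_true gf.
  - by rewrite !extend_false.
Qed.

Lemma G_id : G (fun x => x).
Proof. by case: Ggrp => _ []. Qed.

Definition untwisted q q' := Twist q q' (fun x => x) (fun x => x).

Lemma valid_untwisted f q q' : fin_support q -> fin_support q' ->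
  (forall k, f (Phi q k) = Phi q' k) -> valid_twist f (untwisted q q').
Proof. by move=> fq fq' qq'; do 2!split=> //; split; first exact: G_id. Qed.

Lemma presents_extend s f l : presents f l ->
  presents (extend s f)
    (untwisted (pre false s empty_brick) (pre false s empty_brick) ::
     map (fun a => Twist (pre true s (dom a)) (pre true s (cod a)) (twp a) (twpi a)) l).
Proof.
  move=> [lf [dom1 cod1]]; split; [|split].
  - move=> a [<-|/in_map_iff [c [<- /lf [fd [fc [Gc [cK cf]]]]]]].
    + apply: valid_untwisted; try exact: fin_support_pre fin_support_empty.
      by move=> k; rewrite Phi_pre extend_false.
    + split; first exact: fin_support_pre.
      split; first exact: fin_support_pre.
      split=> //; split=> // k /=.
      by rewrite !Phi_pre extend_true cf.
  - move=> k; rewrite /= multiplicity_cons indicator_pre indicator_empty map_map /=.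
    rewrite -(map_map dom (pre true s)) multiplicity_pre dom1.
    by case: (k s 0).
  - move=> k; rewrite /= multiplicity_cons indicator_pre indicator_empty map_map /=.
    rewrite -(map_map cod (pre true s)) multiplicity_pre cod1.
    by case: (k s 0).
Qed.

Lemma SV_extend s f g : SV G f -> cancels f g -> SV G (extend s f).
Proof.
  move=> /presents_of_SV [l lf] fg.
  exact: (SV_of_presents (presents_extend s lf) (extend_cancels s fg)).
Qed.

Lemma SV_tau g gi : G g -> cancels g gi -> SV G (tau gi).
Proof.
  move=> Gg gK; apply: (@SV_of_presents _ (tau g) [Twist empty_brick empty_brick g gi]).
  - split; last by split=> k; rewrite /multiplicity /= indicator_empty.
    move=> a [<-|[]]; do 2!(split; first exact: fin_support_empty).
    by split=> //; split=> // k; rewrite !Phi_empty.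
  - exact: tau_cancels.
Qed.

(** * Explicit elements: baker maps, bit flips and Thompson maps at one coordinate *)

Definition baker s t k : CS T := cons_at (k s 0) t (tail_at s k).

Lemma baker_cons_at b s t k : baker s t (cons_at b s k) = cons_at b t k.
Proof. by rewrite /baker cons_at_head cons_atK. Qed.

Lemma baker_cancels s t : cancels (baker s t) (baker t s).
Proof.
  split=> k; [elim/(@cons_at_ind _ s): k => b k|elim/(@cons_at_ind _ t): k => b k];
    by rewrite !baker_cons_at.
Qed.

Lemma SV_baker s t : SV G (baker s t).
Proof.
  pose e b u := pre b u (@empty_brick T).
  apply: (@SV_of_presents _ (baker t s)
    [untwisted (e true s) (e true t); untwisted (e false s) (e false t)]).
  - split.
    + move=> a [<-|[<-|[]]]; apply: valid_untwisted;
        try exact: fin_support_pre fin_support_empty;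
        by move=> k; rewrite !Phi_pre !Phi_empty baker_cons_at.
    + by split=> k; rewrite /multiplicity /= !indicator_pre !indicator_empty;
        case: (k _ 0).
  - exact: baker_cancels.
Qed.

Definition flip s k : CS T := cons_at (negb (k s 0)) s (tail_at s k).

Lemma flip_cons_at b s k : flip s (cons_at b s k) = cons_at (negb b) s k.
Proof. by rewrite /flip cons_at_head cons_atK. Qed.

Lemma flip_cancels s : cancels (flip s) (flip s).
Proof.
  split=> k; elim/(@cons_at_ind _ s): k => b k;
    by rewrite !flip_cons_at; case: b.
Qed.

Lemma SV_flip s : SV G (flip s).
Proof.
  pose e b := pre b s (@empty_brick T).
  apply: (@SV_of_presents _ (flip s)
    [untwisted (e true) (e false); untwisted (e false) (e true)]).
  - split.
    + move=> a [<-|[<-|[]]]; apply: valid_untwisted;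
        try exact: fin_support_pre fin_support_empty;
        by move=> k; rewrite !Phi_pre !Phi_empty flip_cons_at.
    + by split=> k; rewrite /multiplicity /= !indicator_pre !indicator_empty;
        case: (k _ 0).
  - exact: flip_cancels.
Qed.

(** The maps [0 <-> 10] fixing [11], and [1 -> 11, 01 -> 10, 00 -> 0], on the
    words at coordinate [s]. *)
Definition swap s k : CS T :=
  if k s 0 then
    if k s 1 then k else cons_at false s (tail_at s (tail_at s k))
  else cons_at true s k.

Definition grow s k : CS T :=
  if k s 0 then cons_at true s k
  else if k s 1 then cons_at true s (cons_at false s (tail_at s (tail_at s k)))
  else tail_at s k.

Definition shrink s k : CS T :=
  if k s 0 then
    if k s 1 then tail_at s k
    else cons_at false s (cons_at true s (tail_at s (tail_at s k)))
  else cons_at false s k.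

Lemma cons_at_second b s k : cons_at b s k s 1 = k s 0.
Proof. by rewrite /cons_at; case: eqS. Qed.

Lemma swap_true_true s k :
  swap s (cons_at true s (cons_at true s k)) = cons_at true s (cons_at true s k).
Proof. by rewrite /swap cons_at_second !cons_at_head. Qed.

Lemma swap_true_false s k :
  swap s (cons_at true s (cons_at false s k)) = cons_at false s k.
Proof. by rewrite /swap cons_at_second !cons_at_head !cons_atK. Qed.

Lemma swap_false s k :
  swap s (cons_at false s k) = cons_at true s (cons_at false s k).
Proof. by rewrite /swap !cons_at_head. Qed.

Lemma grow_true s k : grow s (cons_at true s k) = cons_at true s (cons_at true s k).
Proof. by rewrite /grow cons_at_head. Qed.

Lemma grow_false_true s k :
  grow s (cons_at false s (cons_at true s k)) = cons_at true s (cons_at false s k).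
Proof. by rewrite /grow cons_at_second !cons_at_head !cons_atK. Qed.

Lemma grow_false_false s k :
  grow s (cons_at false s (cons_at false s k)) = cons_at false s k.
Proof. by rewrite /grow cons_at_second !cons_at_head !cons_atK. Qed.

Lemma shrink_true_true s k :
  shrink s (cons_at true s (cons_at true s k)) = cons_at true s k.
Proof. by rewrite /shrink cons_at_second !cons_at_head !cons_atK. Qed.

Lemma shrink_true_false s k :
  shrink s (cons_at true s (cons_at false s k)) = cons_at false s (cons_at true s k).
Proof. by rewrite /shrink cons_at_second !cons_at_head !cons_atK. Qed.

Lemma shrink_false s k :
  shrink s (cons_at false s k) = cons_at false s (cons_at false s k).
Proof. by rewrite /shrink cons_at_head. Qed.

Lemma swap_cancels s : cancels (swap s) (swap s).
Proof.
  split=> k; elim/(@cons_at_ind _ s): k => -[] k;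
    try (elim/(@cons_at_ind _ s): k => -[] k);
    by rewrite ?(swap_true_true, swap_true_false, swap_false).
Qed.

Lemma grow_cancels s : cancels (grow s) (shrink s).
Proof.
  split=> k; elim/(@cons_at_ind _ s): k => -[] k;
    try (elim/(@cons_at_ind _ s): k => -[] k);
    by rewrite ?(grow_true, grow_false_true, grow_false_false,
      shrink_true_true, shrink_true_false, shrink_false).
Qed.

Lemma SV_swap s : SV G (swap s).
Proof.
  pose c b q := pre b s q; pose e b := c b (@empty_brick T).
  apply: (@SV_of_presents _ (swap s)
    [untwisted (e false) (c true (e false)); untwisted (c true (e false)) (e false);
     untwisted (c true (e true)) (c true (e true))]).
  - split.
    + move=> a [<-|[<-|[<-|[]]]]; apply: valid_untwisted;
        try (do ?apply: fin_support_pre; exact: fin_support_empty);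
        move=> k; rewrite !Phi_pre !Phi_empty;
        by rewrite ?(swap_true_true, swap_true_false, swap_false).
    + by split=> k; rewrite /multiplicity /= !indicator_pre !indicator_empty;
        case: (k _ 0); case: (tail_at _ _ _ 0).
  - exact: swap_cancels.
Qed.

Lemma SV_grow s : SV G (grow s).
Proof.
  pose c b q := pre b s q; pose e b := c b (@empty_brick T).
  apply: (@SV_of_presents _ (shrink s)
    [untwisted (e true) (c true (e true)); untwisted (c false (e true)) (c true (e false));
     untwisted (c false (e false)) (e false)]).
  - split.
    + move=> a [<-|[<-|[<-|[]]]]; apply: valid_untwisted;
        try (do ?apply: fin_support_pre; exact: fin_support_empty);
        move=> k; rewrite !Phi_pre !Phi_empty;
        by rewrite ?(grow_true, grow_false_true, grow_false_false).
    + by split=> k; rewrite /multiplicity /= !indicator_pre !indicator_empty;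
        case: (k _ 0); case: (tail_at _ _ _ 0).
  - exact: grow_cancels.
Qed.

End Twists.

(** * Partitions up to halving *)

Section Refinement.
Context {T : Type}.
Implicit Types (s t : T) (b : bool) (k : CS T) (q : T -> list bool).
Implicit Types (p : CS T -> CS T) (l m : list (CS T -> CS T)).

(** A parametrised brick is recorded as the map [p : CS T -> CS T] onto it. *)
Inductive requiv : list (CS T -> CS T) -> list (CS T -> CS T) -> Prop :=
| requiv_trans l l' l'' : requiv l l' -> requiv l' l'' -> requiv l l''
| requiv_perm l l' : Permutation l l' -> requiv l l'
| requiv_split s p l : requiv (p :: l)
    ((fun k => p (cons_at true s k)) :: (fun k => p (cons_at false s k)) :: l)
| requiv_merge s p l : requiv
    ((fun k => p (cons_at true s k)) :: (fun k => p (cons_at false s k)) :: l)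
    (p :: l).

Lemma requiv_sym l l' : requiv l l' -> requiv l' l.
Proof.
  elim=> {l l'} [l l' l'' _ H _ H'|l l' H|s p l|s p l].
  - exact: requiv_trans H' H.
  - exact/requiv_perm/Permutation_sym.
  - exact: requiv_merge.
  - exact: requiv_split.
Qed.

Lemma requiv_app_tail l l' m : requiv l l' -> requiv (l ++ m) (l' ++ m).
Proof.
  elim=> {l l'} [l l' l'' _ H _ H'|l l' H|s p l|s p l].
  - exact: requiv_trans H H'.
  - exact/requiv_perm/Permutation_app_tail.
  - exact: requiv_split.
  - exact: requiv_merge.
Qed.

Lemma requiv_app l l' m m' : requiv l l' -> requiv m m' -> requiv (l ++ m) (l' ++ m').
Proof.
  move=> ll' mm'; apply: (requiv_trans (requiv_app_tail m ll')).
  apply: (requiv_trans (requiv_perm (Permutation_app_comm l' m))).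
  apply: (requiv_trans (requiv_app_tail l' mm')).
  exact/requiv_perm/Permutation_app_comm.
Qed.

(** The trace of [q] on the half with first bit [b] at [s], with that bit deleted so that it is
    again a brick of the whole cube; the list is empty when [q] misses this half. *)
Definition restrict b s q : list (T -> list bool) :=
  match q s with
  | [] => [q]
  | c :: _ => if Bool.eqb c b then [tl_at s q] else []
  end.

Lemma multiplicity_restrict b s Q k :
  multiplicity (flat_map (restrict b s) Q) k = multiplicity Q (cons_at b s k).
Proof.
  elim: Q => [|q Q IH] //=; rewrite multiplicity_app multiplicity_cons IH; congr (_ + _).
  rewrite /restrict; case qs : (q s) => [|c w].
  - rewrite /multiplicity /= Nat.add_0_r /indicator.
    suff H : in_brick q k <-> in_brick q (cons_at b s k).
      by case: excluded_middle_informative => [/H|nq]; case: excluded_middle_informative => //; move/H.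
    split=> qk t i it; have ts : t <> s by move=> ts; move: it; rewrite ts qs /=; lia.
    + by rewrite cons_at_other //; apply: qk.
    + by rewrite -(cons_at_other b k ts); apply: qk.
  - rewrite -{2}(@pre_tl_at _ c s q) ?qs // indicator_pre cons_at_head cons_atK.
    by clear IH; case: c {qs}; case: b; rewrite /multiplicity /= ?Nat.add_0_r.
Qed.

(** A brick with empty word at [s] is halved there; any other brick already lies in one half. The
    rest is a permutation gathering the pieces of each half. *)
Lemma requiv_restrict s p Q :
  requiv (map (fun q k => p (Phi q k)) Q)
    (map (fun q k => p (cons_at true s (Phi q k))) (flat_map (restrict true s) Q) ++
     map (fun q k => p (cons_at false s (Phi q k))) (flat_map (restrict false s) Q)).
Proof.
  elim: Q => [|q Q IH]; first exact: requiv_perm.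
  rewrite /= !map_app.
  set Q1 := map _ (flat_map _ Q) in IH *; set Q0 := map _ (flat_map _ Q) in IH *.
  set A1 := map _ (restrict true s q); set A0 := map _ (restrict false s q).
  have H : requiv [fun k => p (Phi q k)] (A1 ++ A0).
    { rewrite /A1 /A0 /restrict; case qs : (q s) => [|c w] /=.
    + have -> : (fun k => p (cons_at true s (Phi q k))) = (fun k => p (Phi q (cons_at true s k))).
        by apply: functional_extensionality => k; rewrite Phi_cons_at.
      have -> : (fun k => p (cons_at false s (Phi q k))) = (fun k => p (Phi q (cons_at false s k))).
        by apply: functional_extensionality => k; rewrite Phi_cons_at.
      exact: (requiv_split s (fun k => p (Phi q k))).
    + have qE : pre c s (tl_at s q) = q by apply: pre_tl_at; rewrite qs.
      have -> : (fun k => p (Phi q k)) = (fun k => p (cons_at c s (Phi (tl_at s q) k))).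
        by apply: functional_extensionality => k; rewrite -Phi_pre qE.
      by case: c {qs qE} => /=; apply: requiv_perm. }
  apply: (requiv_trans (requiv_app H IH)); apply: requiv_perm.
  rewrite -!app_assoc; apply: Permutation_app_head.
  rewrite !app_assoc; apply: Permutation_app_tail; exact: Permutation_app_comm.
Qed.

(** Induction on a budget [F] of coordinates: cutting at its head [s] shortens the nonempty words at
    [s], each half reduces to a single piece, and the two pieces merge. The map [p] varies because
    each half is treated inside [p] composed with [cons_at b s]. *)
Lemma requiv_partition_bounded F Q p :
  (forall q, In q Q -> forall s, length (q s) <= count_occ eqS F s) ->
  (forall k, multiplicity Q k = 1) ->
  requiv (map (fun q k => p (Phi q k)) Q) [p].
Proof.
  elim: F Q p => [|s F IH] Q p HF Q1.
  - have Qe : forall q, In q Q -> q = empty_brick.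
      move=> q /HF qF; apply: functional_extensionality => s.
      by apply/length_zero_iff_nil; have := qF s; rewrite /=; lia.
    (* With all words empty, counting at one point leaves exactly one brick. *)
    have := Q1 (fun _ _ => false); clear HF Q1; case: Q Qe => [|q [|q' Q]] Qe; first by [].
    + move=> _; rewrite (Qe q) /=; first by left.
      have -> : (fun k => p (Phi empty_brick k)) = p.
        by apply: functional_extensionality => k; rewrite Phi_empty.
      exact: requiv_perm.
    + rewrite (Qe q); first by left.
      rewrite (Qe q'); first by right; left.
      by rewrite !multiplicity_cons !indicator_empty; lia.
  - apply: (requiv_trans (requiv_restrict s p Q)).
    have HFb : forall b q, In q (flat_map (restrict b s) Q) ->
        forall t, length (q t) <= count_occ eqS F t.
    { move=> b q /in_flat_map [q' [/HF qF]]; rewrite /restrict => + t.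
      have := qF t; have := qF s; rewrite /=; case: (eqS s t) => [<-|st].
      + case: (eqS s s) => // _; case qs : (q' s) => [|c w] /=.
          by move=> _ _ [<-|//]; rewrite qs /=; lia.
        by case: Bool.eqb => //= H _ [<-|//]; rewrite /tl_at; case: eqS => //; rewrite qs /=; lia.
      + case: (eqS s s) => // _ _ qt; case qs : (q' s) => [|c w] /=.
          by move=> [<-|//].
        by case: Bool.eqb => //= -[<-|//]; rewrite /tl_at; case: eqS => // ts; case: st. }
    have IHb b := IH _ (fun k => p (cons_at b s k)) (HFb b) (fun k => eq_trans (multiplicity_restrict b s Q k) (Q1 _)).
    apply: (requiv_trans (requiv_app (IHb true) (IHb false))).
    exact: requiv_merge.
Qed.

Lemma requiv_partition Q p :
  (forall q, In q Q -> fin_support q) -> (forall k, multiplicity Q k = 1) ->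
  requiv (map (fun q k => p (Phi q k)) Q) [p].
Proof.
  move=> Qfin; suff [F QF] : exists F, forall q, In q Q -> forall s, length (q s) <= count_occ eqS F s.
    exact: (requiv_partition_bounded F).
  elim: Q Qfin => [|q Q IH] Qfin; first by exists [].
  have [F QF] := IH (fun q' Qq' => Qfin q' (or_intror Qq')).
  have [Fq qF] := Qfin q (or_introl eq_refl).
  (* Each coordinate is listed at least as often as the word of [q] there is long; repetitions in
     [Fq] only enlarge the bound. *)
  exists (flat_map (fun t => repeat t (length (q t))) Fq ++ F) => q' qq' s.
  rewrite count_occ_app; case: qq' => [<-|/QF/(_ s)]; last lia.
  suff : length (q s) <= count_occ eqS (flat_map (fun t => repeat t (length (q t))) Fq) s by lia.
  case qs : (q s) => [|c w]; first by rewrite /=; lia.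
  rewrite -qs; have := qF s; rewrite qs => /(_ ltac:(done)) {qF}.
  elim: Fq => [//|t Fq IHF] /= [->|/IHF]; rewrite count_occ_app.
  - by rewrite count_occ_repeat_eq // qs /=; lia.
  - by move=> /=; lia.
Qed.

End Refinement.

(** * Mapping the comb partition onto arbitrary partitions *)

Section Generation.
Context {T : Type}.
Implicit Types (s t : T) (b : bool) (k : CS T) (q : T -> list bool).
Implicit Types (p f e : CS T -> CS T) (l m : list (CS T -> CS T)).
Variables (s0 : T) (L : list (CS T -> CS T)).
Hypothesis Lbij : forall f, In f L -> is_bij f.

(** The two starting levels for copies of [f]: conjugation by [grow] deepens a copy on [1] or below,
    but does not turn [f] itself into its copy on [1]. *)
Definition gen_both f : Prop := gen L f /\ gen L (extend s0 f).

Lemma gen_both_comp f e : gen_both f -> gen_both e -> gen_both (fun k => f (e k)).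
Proof.
  move=> [f0 f1] [e0 e1]; split; first exact: gen_comp.
  by rewrite extend_comp; apply: gen_comp.
Qed.

Lemma gen_both_inv f fi : gen_both f -> cancels f fi -> gen_both fi.
Proof.
  move=> [f0 f1] fK; split; first exact: (gen_inv Lbij f0 fK).
  exact: (gen_inv Lbij f1 (extend_cancels _ fK)).
Qed.

Lemma gen_both_id : gen_both (fun k => k).
Proof. by split; rewrite ?extend_id; apply: gen_id. Qed.

(** Parametrises the comb brick [1^n] at [s0]; preceded by [cons_at false s0] it parametrises
    [1^n 0]. *)
Definition deep n k := Nat.iter n (cons_at true s0) k.
Arguments deep : simpl never.
Definition extend_iter n f := Nat.iter n (extend s0) f.

Lemma deep_add n n' k : deep (n + n') k = deep n (deep n' k).
Proof. exact: Nat.iter_add. Qed.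

Lemma deep_S n k : deep (S n) k = deep n (cons_at true s0 k).
Proof. by rewrite -Nat.add_1_r deep_add. Qed.

Lemma extend_iter_deep n f k : extend_iter n f (deep n k) = deep n (f k).
Proof. by elim: n => [//|n IH]; rewrite /= extend_true IH. Qed.

Lemma extend_iter_off n j f k : j < n ->
  extend_iter n f (deep j (cons_at false s0 k)) = deep j (cons_at false s0 k).
Proof.
  elim: n j => [|n IH] [|j] jn /=; try lia; first by rewrite extend_false.
  by rewrite extend_true IH //; lia.
Qed.

Lemma deep_cases n k :
  (exists k', k = deep n k') \/ (exists j k', j < n /\ k = deep j (cons_at false s0 k')).
Proof.
  elim: n k => [|n IH] k; first by left; exists k.
  elim/(@cons_at_ind _ s0): k => -[] k; last by right; exists 0, k; split=> //; lia.
  case: (IH k) => [[k' ->]|[j [k' [jn ->]]]]; first by left; exists k'.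
  by right; exists (S j), k'; split=> //; lia.
Qed.

Hypothesis Lgrow : gen L (grow s0).
Hypothesis Lflip : gen_both (flip s0).
Hypothesis Lswap : gen_both (swap s0).

Lemma gen_extend_iter n f : gen_both f -> gen L (extend_iter n f).
Proof.
  move=> [f0 f1]; case: n => [//|n]; elim: n => [//|n IH].
  have Lshrink := gen_inv Lbij Lgrow (grow_cancels s0).
  (* [shrink] takes [11] to [1], where the copy acts, and takes [10] and [0] into the half [0],
     which the copy fixes; [grow] then returns. *)
  apply: (gen_ext _ (gen_comp Lgrow (gen_comp IH Lshrink))) => k.
  elim/(@cons_at_ind _ s0): k => -[] k; first elim/(@cons_at_ind _ s0): k => -[] k.
  - by rewrite shrink_true_true /= extend_true grow_true !extend_true.
  - by rewrite shrink_true_false /= !extend_false grow_false_true extend_true extend_false.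
  - by rewrite shrink_false /= !extend_false grow_false_false.
Qed.

(** The level of a piece is the number of pieces after it, so changes at the front of the list do
    not renumber the rest. *)
Fixpoint realizes_tail f l : Prop :=
  match l with
  | [] => True
  | p :: l' => (forall k, f (deep (length l') (cons_at false s0 k)) = p k) /\ realizes_tail f l'
  end.

(** [f] maps the bricks [1^n, 1^(n-1)0, ..., 10, 0] at [s0] onto the [n+1]
    pieces of [l], in this order. *)
Definition realizes f l : Prop :=
  match l with
  | [] => True
  | p :: l' => (forall k, f (deep (length l') k) = p k) /\ realizes_tail f l'
  end.

Definition realizable l : Prop := exists2 f, gen L f & realizes f l.

Lemma realizes_tail_extend f e l n : length l <= n ->
  realizes_tail f l -> realizes_tail (fun k => f (extend_iter n e k)) l.
Proof.
  elim: l => [//|p l IH] /= ln [fp fl]; split; last by apply: IH => //; lia.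
  by move=> k; rewrite extend_iter_off //; lia.
Qed.

(** The copy of [e] on the deepest comb brick fixes all the other comb bricks. *)
Lemma realizable_comp e p l : gen_both e ->
  realizable (p :: l) -> realizable ((fun k => p (e k)) :: l).
Proof.
  move=> Le [f Lf [fp fl]]; exists (fun k => f (extend_iter (length l) e k)).
    by apply: gen_comp => //; apply: gen_extend_iter.
  split; last exact: realizes_tail_extend.
  by move=> k; rewrite extend_iter_deep fp.
Qed.

(** With [n] the length of [m], the copy of [swap] on [1^n] exchanges [1^n 0] with [1^n 10] and
    fixes [1^n 11], which contains all the pieces of [l]. *)
Lemma realizes_tail_swap f l m p p' :
  realizes_tail f (l ++ p :: p' :: m) ->
  realizes_tail (fun k => f (extend_iter (length m) (swap s0) k)) (l ++ p' :: p :: m).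
Proof.
  elim: l => [|p'' l IH] /=.
  - move=> [fp [fp' fm]]; split; [|split]; last exact: realizes_tail_extend.
    + move=> k; rewrite -fp' deep_S extend_iter_deep /=.
      by rewrite swap_true_false.
    + move=> k; rewrite -fp extend_iter_deep swap_false.
      by rewrite deep_S.
  - move=> [fp'' /IH fl]; split=> // k; rewrite -fp'' !length_app /=.
    have -> : length l + S (S (length m)) = length m + (2 + length l) by lia.
    by rewrite !deep_add extend_iter_deep /deep /= swap_true_true.
Qed.

Lemma realizable_swap l m p p' :
  realizable (l ++ p :: p' :: m) -> realizable (l ++ p' :: p :: m).
Proof.
  move=> [f Lf]; case: l => [|p'' l] /=.
  (* The first two pieces occupy [1^(n+1)] and [1^n 0], with [n] the length of [m]; these are
     exchanged by a flip rather than by [swap]. *)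
  - move=> [fp [fp' fm]]; exists (fun k => f (extend_iter (length m) (flip s0) k)).
      by apply: gen_comp => //; apply: gen_extend_iter.
    split; [|split]; last exact: realizes_tail_extend.
    + move=> k; rewrite -fp' deep_S extend_iter_deep /=.
      by rewrite flip_cons_at.
    + move=> k; rewrite -fp extend_iter_deep flip_cons_at.
      by rewrite deep_S.
  - move=> [fp'' fl]; exists (fun k => f (extend_iter (length m) (swap s0) k)).
      by apply: gen_comp => //; apply: gen_extend_iter.
    split; last exact: realizes_tail_swap.
    move=> k; rewrite -fp'' !length_app /=.
    have -> : length l + S (S (length m)) = length m + (2 + length l) by lia.
    by rewrite !deep_add extend_iter_deep /deep /= swap_true_true.
Qed.

Lemma realizable_perm l m : Permutation l m -> realizable l -> realizable m.
Proof.
  (* An arbitrary prefix is carried along, because the skip case of [Permutation] fixes the head of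
     the list. *)
  move=> lm; rewrite -[l]/([] ++ l) -[m]/([] ++ m).
  elim: lm [] => {l m} [//|p l m _ IH|p p' l|l m n _ IH _ IH'] r.
  - by move=> H; have := IH (r ++ [p]); rewrite -!app_assoc; apply.
  - exact: realizable_swap.
  - by move=> /IH /IH'.
Qed.

Hypothesis Lbaker : forall t, gen_both (baker s0 t).

(** The comb can be refined only at [s0]; a baker map on the deepest brick turns that halving into
    one at [t]. *)
Lemma realizable_split t p l : realizable (p :: l) ->
  realizable ((fun k => p (cons_at true t k)) :: (fun k => p (cons_at false t k)) :: l).
Proof.
  move=> /(realizable_comp (Lbaker t)) [f Lf [fp fl]]; exists f => //.
  split; last split=> //; move=> k /=.
  - by rewrite deep_S fp baker_cons_at.
  - by rewrite fp baker_cons_at.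
Qed.

Lemma realizable_merge t p l :
  realizable ((fun k => p (cons_at true t k)) :: (fun k => p (cons_at false t k)) :: l) ->
  realizable (p :: l).
Proof.
  move=> [f Lf [fp1 [fp0 fl]]].
  (* It then suffices to realize [p] composed with [baker s0 t], whose halves at [s0] are the given
     halves of [p] at [t]. *)
  have -> : p = fun k => p (baker s0 t (baker t s0 k)).
    apply: functional_extensionality => k.
    by rewrite (proj2 (baker_cancels s0 t)).
  apply: (@realizable_comp _ (fun k => p (baker s0 t k))).
    exact: gen_both_inv (Lbaker t) (baker_cancels s0 t).
  exists f => //; split=> // k.
  elim/(@cons_at_ind _ s0): k => -[] k; rewrite baker_cons_at.
  - by rewrite -fp1 /= deep_S.
  - by rewrite -fp0.
Qed.

Lemma realizable_requiv l m : requiv l m -> realizable l -> realizable m.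
Proof.
  elim=> {l m} [l l' l'' _ H _ H'|l l' H|t p l|t p l].
  - by move=> /H /H'.
  - exact: realizable_perm.
  - exact: realizable_split.
  - exact: realizable_merge.
Qed.

Lemma realizable_partition Q :
  (forall q, In q Q -> fin_support q) -> (forall k, multiplicity Q k = 1) ->
  realizable (map Phi Q).
Proof.
  move=> Qfin Q1.
  apply: (realizable_requiv (requiv_sym (requiv_partition Q (fun k => k) Qfin Q1))).
  by exists (fun k => k); first exact: gen_id.
Qed.

(** [realizable_comp] reaches only the first piece, so each piece is moved to the front, modified
    and moved back. *)
Lemma realizable_comp_map {A : Type} (P e : A -> CS T -> CS T) (xs : list A) :
  (forall a, In a xs -> gen_both (e a)) ->
  realizable (map P xs) -> realizable (map (fun a k => P a (e a k)) xs).
Proof.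
  move=> Le; rewrite -[map P _]/([] ++ _) -[map _ _ in X in _ -> X]/([] ++ _).
  elim: xs [] Le => [//|a xs IH] r Le /= H.
  have := IH (r ++ [fun k => P a (e a k)]); rewrite -!app_assoc; apply.
    by move=> c cas; apply: Le; right.
  apply: (realizable_perm (Permutation_middle _ _ _)).
  apply: (@realizable_comp (e a)); first by apply: Le; left.
  by apply: (realizable_perm (Permutation_sym (Permutation_middle _ _ _))).
Qed.

(** The comb bricks cover the cube, and both maps are prescribed on every one of them; the empty
    list would prescribe nothing. *)
Lemma realizes_agree {A : Type} (P P' : A -> CS T -> CS T) (h f f' : CS T -> CS T) (xs : list A) :
  (forall a, In a xs -> forall k, h (P a k) = P' a k) -> xs <> [] ->
  realizes f (map P xs) -> realizes f' (map P' xs) -> forall k, h (f k) = f' k.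
Proof.
  case: xs => [//|a xs] hP _ /= [fa fas] [fa' fas'] k.
  rewrite length_map in fa; rewrite length_map in fa'.
  case: (deep_cases (length xs) k) => [[k' ->]|[j [k' [jas ->]]]].
    by rewrite fa fa' hP //; left.
  have {hP}: forall c, In c xs -> forall k, h (P c k) = P' c k.
    by move=> c cas; apply: hP; right.
  elim: xs jas fas fas' {fa fa'} => [|c xs IH] /= jas; first lia.
  move=> [fc fas] [fc' fas'] hP; rewrite length_map in fc; rewrite length_map in fc'.
  case: (Nat.eq_dec j (length xs)) => [->|jn].
    by rewrite fc fc' hP //; left.
  by apply: IH => //; [lia|move=> d das; apply: hP; right].
Qed.

Lemma gen_of_presents (G : (T -> T) -> Prop) (h : CS T -> CS T) (l : list (@twist T)) :
  (forall g gi, G g -> cancels g gi -> gen_both (tau gi)) ->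
  presents G h l -> gen L h.
Proof.
  move=> Ltau [lh [dom1 cod1]].
  have [f Lf ff] : realizable (map (fun a => Phi (dom a)) l).
    rewrite -(map_map dom (@Phi T)); apply: realizable_partition => // q.
    by move=> /in_map_iff [a [<- /lh []]].
  (* The second map absorbs the twists on the comb bricks, so that [h] composed with [f] is [f'] on
     each brick. *)
  have [f' Lf' ff'] : realizable (map (fun a k => Phi (cod a) (tau (twpi a) k)) l).
    apply: (realizable_comp_map (fun a => Phi (cod a)) (fun a => tau (twpi a))).
      by move=> a /lh [_ [_ [Ga [aK _]]]]; apply: (Ltau (twp a)).
    rewrite -(map_map cod (@Phi T)); apply: realizable_partition => // q.
    by move=> /in_map_iff [a [<- /lh [_ []]]].
  have hf : forall k, h (f k) = f' k.
    refine (@realizes_agree _ _ _ h _ _ l _ _ ff ff').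
      by move=> a /lh [_ [_ [_ [_ ah]]]] k; apply: ah.
    by move=> l0; have := dom1 (fun _ _ => false); rewrite l0.
  have [fi [Lfi [fK fK']]] := gen_hxsinverse Lbij Lf.
  by apply: (gen_ext _ (gen_comp Lf' Lfi)) => k; rewrite -hf fK'.
Qed.

End Generation.

(** * Finite generating sets *)

Section Sufficiency.
Context {T : Type}.
Variable G : (T -> T) -> Prop.
Hypothesis Ggrp : is_perm_subgroup G.

Lemma group_inverse g : G g -> exists gi, G gi /\ cancels g gi.
Proof.
  move: Ggrp => [Gbij [_ [_ Ginv]]] Gg; have [gi [gK gK']] := Gbij g Gg.
  by exists gi; split=> //; apply: (Ginv g).
Qed.

Lemma SV_bij (f : CS T -> CS T) : SV G f -> is_bij f.
Proof. by move=> [[_ [g [_ [fg gf]]]] _]; exists g. Qed.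

(** Conjugating [baker s t] by the twist of [g] gives [baker (g s) (g t)], which is preceded here by
    [baker s (g s)]. *)
Lemma baker_cocycle (g gi : T -> T) s t k : cancels g gi ->
  baker s (g t) k = tau gi (baker s t (tau g (baker s (g s) k))).
Proof.
  move=> gK; elim/(@cons_at_ind _ s): k => b k.
  rewrite !baker_cons_at (tau_cons_at _ _ _ (cancels_sym gK)) (proj1 gK).
  rewrite baker_cons_at (tau_cons_at _ _ _ gK).
  by rewrite (proj2 (tau_cancels gK)).
Qed.

(** Handles inverse letters: [baker (g s) s] is the inverse of [baker s (g s)], which is a generator
    when [g] is one and [s] is the base point. *)
Lemma baker_inverse_image (g gi : T -> T) s k : cancels g gi ->
  baker s (gi s) k = tau g (baker (g s) s (tau gi k)).
Proof.
  move=> gK; elim/(@cons_at_ind _ s): k => b k.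
  rewrite (tau_cons_at _ _ _ gK) !baker_cons_at.
  rewrite (tau_cons_at _ _ _ (cancels_sym gK)).
  by rewrite (proj1 (tau_cancels gK)).
Qed.

Lemma baker_id s (k : CS T) : baker s s k = k.
Proof. exact: tail_atK. Qed.

Lemma fin_gen_SV : inhabited T -> fin_gen G -> finitely_many_orbits G -> fin_gen (SV G).
Proof.
  move=> [s0] [Lg [LgG LgP]] [reps repsP].
  (* Baker maps towards the orbit representatives and the images of [s0] under the generators
     suffice by the cocycle rule. [tau g] is the twist by the inverse of [g]. *)
  pose B := [flip s0; swap s0] ++ map tau Lg ++
    map (baker s0) (reps ++ map (fun g => g s0) Lg).
  pose L := grow s0 :: B ++ map (extend s0) B.
  have B_SV : forall f, In f B -> SV G f.
    { move=> f; rewrite /B !in_app_iff /= => -[[<-|[<-|[]]]|[]].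
    - exact: SV_flip.
    - exact: SV_swap.
    - move=> /in_map_iff [g [<- /LgG Gg]].
      have [gi [Ggi gK]] := group_inverse Gg.
      exact: SV_tau Ggi (cancels_sym gK).
    - by move=> /in_map_iff [t [<- _]]; apply: SV_baker. }
  have L_SV : forall f, In f L -> SV G f.
    move=> f Lf.
    have [<-|/in_app_iff [/B_SV //|/in_map_iff [e [<- /B_SV Be]]]] :
      grow s0 = f \/ In f (B ++ map (extend s0) B) by []; first exact: SV_grow.
    have [ei eK] := SV_bij Be; exact: SV_extend Be eK.
  exists L; split=> // h SVh.
  have Lbij : forall f, In f L -> is_bij f by move=> f /L_SV /SV_bij.
  have LB : forall f, In f B -> gen_both s0 L f.
    move=> f Bf; split; apply: gen_in; right; apply/in_app_iff; [by left|right].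
    exact: in_map.
  (* [tau] reverses composition, so the letters of a word are applied in the opposite order. *)
  have Ltau : forall g, gen Lg g -> gen_both s0 L (tau g).
    { have tau_in g : In g Lg -> gen_both s0 L (tau g).
      by move=> Lgg; apply: LB; rewrite /B !in_app_iff; right; left; apply: in_map.
    move=> g; elim=> {g} [|g f Lgg _ IH|g gi f Lgg gK gK' _ IH|f f' _ IH ff'].
    - exact: (gen_both_id s0 L).
    - exact: gen_both_comp IH (tau_in _ Lgg).
    - have gKK : cancels g gi by [].
      exact: (gen_both_comp IH (gen_both_inv Lbij (tau_in g Lgg) (cancels_sym (tau_cancels gKK)))).
    - by rewrite -(functional_extensionality _ _ ff'). }
  (* The factor [baker s0 (g s0)] of the cocycle rule is treated first, by induction on the word [g]
     and the rule with [t = f s0]. *)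
  have Lbaker0 : forall g, gen Lg g -> gen_both s0 L (baker s0 (g s0)).
    { have baker_in g : In g Lg -> gen_both s0 L (baker s0 (g s0)).
      move=> Lgg; apply: LB; rewrite /B !in_app_iff; right; right.
      by apply: in_map; apply/in_app_iff; right; apply: (in_map (fun g => g s0)).
    move=> g; elim=> {g} [|g f Lgg _ IH|g gi f Lgg gK gK' Lgf IH|f f' _ IH ff'].
    - rewrite (functional_extensionality _ _ (baker_id s0)); exact: gen_both_id.
    - have [gi [Ggi gK]] := group_inverse (LgG g Lgg).
      rewrite (functional_extensionality _ _ (fun k => baker_cocycle s0 (f s0) k gK)).
      apply: (gen_both_comp (Ltau _ (LgP _ Ggi))).
      apply: (gen_both_comp IH).
      by apply: gen_both_comp; [apply: (Ltau _ (gen_in _ _ Lgg))|apply: baker_in].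
    - have gKK : cancels g gi by [].
      have Lgi : gen Lg gi := gen_mulinv _ _ Lgg gK gK' (gen_id Lg).
      rewrite (functional_extensionality _ _ (fun k => baker_cocycle s0 (f s0) k (cancels_sym gKK))).
      apply: (gen_both_comp (Ltau _ (gen_in _ _ Lgg))).
      apply: (gen_both_comp IH); apply: (gen_both_comp (Ltau _ Lgi)).
      rewrite (functional_extensionality _ _ (fun k => baker_inverse_image s0 k gKK)).
      apply: (gen_both_comp (Ltau _ (gen_in _ _ Lgg))).
      apply: gen_both_comp (Ltau _ Lgi).
      exact: (gen_both_inv Lbij (baker_in g Lgg) (baker_cancels _ _)).
    - by rewrite -ff'. }
  have Lbaker : forall t, gen_both s0 L (baker s0 t).
    move=> t; have [r [g [rr [Gg <-]]]] := repsP t.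
    have [gi [Ggi gK]] := group_inverse Gg.
    rewrite (functional_extensionality _ _ (fun k => baker_cocycle s0 r k gK)).
    apply: (gen_both_comp (Ltau _ (LgP _ Ggi))).
    apply: (@gen_both_comp _ _ _ (baker s0 r)).
      by apply: LB; rewrite /B !in_app_iff; right; right; apply: in_map; apply/in_app_iff; left.
    by apply: (gen_both_comp (Ltau _ (LgP _ Gg))); apply/Lbaker0/LgP.
  have [l lh] := presents_of_SV SVh.
  apply: (gen_of_presents Lbij _ _ _ Lbaker _ lh).
  - by apply: gen_in; left.
  - by apply: LB; left.
  - by apply: LB; right; left.
  - move=> g gi Gg gK; apply/Ltau/LgP.
    by case: Ggrp => [_ [_ [_ Ginv]]]; case: gK; apply: Ginv.
Qed.

End Sufficiency.

(** * Germs *)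

Section Necessity.
Context {T : Type}.
Variable G : (T -> T) -> Prop.
Hypothesis Ggrp : is_perm_subgroup G.

Lemma gen_subgroup L : (forall g, In g L -> G g) -> forall g, gen L g -> G g.
Proof.
  move: (Ggrp) => [_ [G1 [Gmul Ginv]]] LG g.
  elim=> {g} [//|g h Lg _ Gh|g gi h Lg gK gK' _ Gh|h h' _ Gh hh'].
  - by apply: Gmul => //; apply: LG.
  - by apply: (Gmul gi) => //; apply: (Ginv g) => //; apply: LG.
  - by rewrite -(functional_extensionality _ _ hh').
Qed.

(** Near [x], the map [h] replaces the prefixes of lengths [a] by prefixes of
    lengths [b] and moves the remaining tails by the permutation [g]. *)
Definition germ (h : CS T -> CS T) (x : CS T) (g gi : T -> T) (a b : T -> nat) : Prop :=
  cancels g gi /\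
  forall x' : CS T, (forall s n, n < a s -> x' s n = x s n) ->
    (forall s n, h x' s (b s + n) = x' (gi s) (a (gi s) + n)) /\
    (forall s n, n < b s -> h x' s n = h x s n).

(** The prefix lengths [b] produced by the first germ and [a'] consumed by the second need not
    agree; truncated subtraction lengthens the shorter one at each coordinate. *)
Lemma germ_comp h h' x g gi a b g' gi' a' b' :
  germ h x g gi a b -> germ h' (h x) g' gi' a' b' ->
  germ (fun k => h' (h k)) x (fun s => g' (g s)) (fun s => gi (gi' s))
    (fun u => a u + (a' (g u) - b (g u)))
    (fun s => b' s + (b (gi' s) - a' (gi' s))).
Proof.
  move=> [gK H] [gK' H']; split; first exact: cancels_comp.
  move=> x' xx'.
  have [//|Ha Hb] := H x'.
    by move=> s n sn; apply: xx'; lia.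
  have [//|Ha0 _] := H x.
  have [|Ha' Hb'] := H' (h x').
    move=> s n sn; case: (Nat.lt_ge_cases n (b s)) => [|bn]; first exact: Hb.
    have -> : n = b s + (n - b s) by lia.
    by rewrite Ha Ha0 xx' // (proj2 gK); lia.
  split=> s n.
  - rewrite -Nat.add_assoc Ha' (proj2 gK).
    set t := gi' s.
    have -> : a' t + (b t - a' t + n) = b t + (a' t - b t + n) by lia.
    by rewrite Ha; congr (x' _ _); lia.
  - case: (Nat.lt_ge_cases n (b' s)) => [|bn]; first by move=> nb _; apply: Hb'.
    have -> : n = b' s + (n - b' s) by lia.
    move=> nb; have [//|Ha0' _] := H' (h x).
    by rewrite Ha' Ha0' Hb //; lia.
Qed.

Lemma germ_of_presents h l x : presents G h l -> exists2 c, In c l &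
  germ h x (twp c) (twpi c) (fun s => length (dom c s)) (fun s => length (cod c s)).
Proof.
  move=> lh; have [c lc xc] := presents_dom x lh.
  exists c => //; have [_ [_ [_ [cK hc]]]] := proj1 lh c lc; split=> // x' xx'.
  have xc' : in_brick (dom c) x' by move=> s i si; rewrite xx' //; apply: xc.
  rewrite (Phi_of_in_brick xc') (Phi_of_in_brick xc) !hc; split=> s n.
  - rewrite /Phi /concat /tau.
    case: Nat.ltb_spec; first lia; case: Nat.ltb_spec; first lia.
    by move=> _ _; congr (x' _ _); lia.
  - by move=> /Nat.ltb_lt ns; rewrite /Phi /concat ns.
Qed.

Lemma presents_finite_data h l : presents G h l -> exists F : list T,
  forall c, In c l -> forall s, ~ In s F -> dom c s = [] /\ cod c s = [].
Proof.
  move=> [lv _]; elim: l lv => [|c l IH] lv; first by exists [].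
  have [F lF] : exists F : list T,
      forall c, In c l -> forall s, ~ In s F -> dom c s = [] /\ cod c s = [].
    by apply: IH => d ld; apply: lv; right.
  have [[F1 cF1] [[F2 cF2] _]] := lv c (or_introl eq_refl).
  exists (F1 ++ F2 ++ F) => d dl s; rewrite !in_app_iff => nF.
  case: dl => [<-|ld]; last by apply: lF => //; tauto.
  by split; apply: NNPP; [move=> /cF1|move=> /cF2]; tauto.
Qed.

Lemma generators_finite_data L : (forall h, In h L -> SV G h) ->
  exists (Lg : list (T -> T)) (F : list T),
    (forall g, In g Lg -> G g) /\
    forall h, In h L -> exists l, presents G h l /\
      forall c, In c l -> In (twp c) Lg /\
        forall s, ~ In s F -> dom c s = [] /\ cod c s = [].
Proof.
  elim: L => [|h L IH] LSV; first by exists [], [].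
  have [|Lg [F [LgG LF]]] := IH; first by move=> e Le; apply: LSV; right.
  have [l lh] := presents_of_SV (LSV h (or_introl eq_refl)).
  have [F' lF'] := presents_finite_data lh.
  exists (map twp l ++ Lg), (F' ++ F); split.
    move=> g /in_app_iff [/in_map_iff [c [<- lc]]|/LgG //].
    by have [_ [_ []]] := proj1 lh c lc.
  move=> e [<-|/LF [l' [le lP]]].
  - exists l; split=> // c lc; split; first by apply/in_app_iff; left; apply: in_map.
    by move=> s; rewrite in_app_iff => sF; apply: lF' => //; tauto.
  - exists l'; split=> // c lc; have [cLg cF] := lP c lc.
    split; first by apply/in_app_iff; right.
    by move=> s; rewrite in_app_iff => sF; apply: cF; tauto.
Qed.

(** * Prefix changes and permutations along words *)

Definition orbit_union (F : list T) (s : T) : Prop :=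
  exists r g, In r F /\ G g /\ g r = s.

Definition tame (Lg : list (T -> T)) (F : list T) (h : CS T -> CS T) : Prop :=
  forall x, exists g gi a b, gen Lg g /\ germ h x g gi a b /\
    forall s, ~ orbit_union F s -> a s = 0 /\ b s = 0.

(** The composite lengths at [s] involve the germs only at [s], [g s] and [gi' s], which share a
    [G]-orbit. This is why [tame] refers to orbits of [F] instead of [F]. *)
Lemma tame_comp Lg F h h' : (forall g, In g Lg -> G g) ->
  tame Lg F h -> tame Lg F h' -> tame Lg F (fun k => h' (h k)).
Proof.
  move=> LgG th th' x.
  have [g [gi [a [b [Lgg [gh hF]]]]]] := th x.
  have [g' [gi' [a' [b' [Lgg' [gh' hF']]]]]] := th' (h x).
  have H := germ_comp gh gh'.
  do 4!eexists; split; last split; [|exact: H|]; first exact: gen_comp.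
  have [_ [_ [Gmul _]]] := Ggrp.
  have Gg := gen_subgroup LgG Lgg; have Gg' := gen_subgroup LgG Lgg'.
  move=> s nF /=.
  have nF1 : ~ orbit_union F (g s).
    move=> [r [e [Fr [Ge er]]]]; apply: nF.
    have [ei [Gei eK]] := group_inverse Ggrp _ Gg.
    exists r, (fun t => ei (e t)); split=> //; split; first exact: Gmul.
    by rewrite er (proj1 eK).
  have nF2 : ~ orbit_union F (gi' s).
    move=> [r [e [Fr [Ge er]]]]; apply: nF.
    exists r, (fun t => g' (e t)); split=> //; split; first exact: Gmul.
    by rewrite er (proj2 (proj1 gh')).
  have [-> _] := hF s nF; have [-> _] := hF' _ nF1.
  by have [_ ->] := hF' s nF; have [_ ->] := hF _ nF2.
Qed.

(** Germs of generators are read off their presentations, and those of inverses off the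
    presentations with [dom] and [cod] exchanged. *)
Lemma tame_gen L Lg F : (forall g, In g Lg -> G g) ->
  (forall h, In h L -> exists l, presents G h l /\
      forall c, In c l -> In (twp c) Lg /\
        forall s, ~ In s F -> dom c s = [] /\ cod c s = []) ->
  forall h, gen L h -> tame Lg F h.
Proof.
  move=> LgG LP.
  have offF s : ~ orbit_union F s -> ~ In s F.
    move=> nF Fs; apply: nF; exists s, (fun t => t); split=> //; split=> //.
    by case: Ggrp => _ [].
  have tameL h : In h L -> tame Lg F h.
    move=> /LP [l [lh lP]] x; have [c lc gc] := germ_of_presents x lh.
    have [cLg cF] := lP c lc; do 4!eexists; split; last split; [|exact: gc|].
      exact: gen_in.
    by move=> s /offF /cF [-> ->].
  have tameLi h hi : In h L -> cancels h hi -> tame Lg F hi.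
    move=> /LP [l [lh lP]] hK x.
    have [_ /in_map_iff [c [<- lc]] gc] := germ_of_presents x (presents_inverse Ggrp lh hK).
    have [cLg cF] := lP c lc; do 4!eexists; split; last split; [|exact: gc|].
      have [_ [_ [_ [[cK cK'] _]]]] := proj1 lh c lc.
      exact: (gen_mulinv _ _ cLg cK cK' (gen_id Lg)).
    by move=> s /offF /cF [ds cs] /=; rewrite ds cs.
  move=> h; elim=> {h} [|h h' Lh _ th'|h hi h' Lh hK hK' _ th'|h h' _ th hh'].
  - move=> x; exists (fun s => s), (fun s => s), (fun _ => 0), (fun _ => 0).
    by split; [exact: gen_id|split].
  - exact: tame_comp th' (tameL _ Lh).
  - by apply: tame_comp th' _ => //; apply: (tameLi h).
  - by rewrite -(functional_extensionality _ _ hh').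
Qed.

Lemma fin_gen_SV_inv : fin_gen (SV G) -> fin_gen G /\ finitely_many_orbits G.
Proof.
  move=> [L [LSV LP]]; have [Lg [F [LgG LF]]] := generators_finite_data _ LSV.
  have tameSV h (SVh : SV G h) := @tame_gen L Lg F LgG LF h (LP h SVh).
  pose x0 : CS T := fun _ _ => false.
  split.
  - exists Lg; split=> // g0 Gg0; have [gi0 [_ gK0]] := group_inverse Ggrp _ Gg0.
    have [g [gi [a [b [Lgg [[gK H] _]]]]]] := tameSV _ (SV_tau Ggrp Gg0 gK0) x0.
    suff gi_eq : forall s, gi s = gi0 s.
      apply: (gen_ext _ Lgg) => s.
      by rewrite -(proj2 gK (g0 s)) gi_eq (proj1 gK0).
    move=> s; apply: NNPP => gis.
    (* This point shares with [x0] the prefixes of lengths [a] and is 1 beyond the prefix at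
       coordinate [gi0 s] only. The offset [a (gi0 s)] makes the twist read a 1 there, while the
       germ reads a 0 at [gi s]. *)
    pose x' : CS T := fun t m => if eqS t (gi0 s) then a t <=? m else false.
    have [|/(_ s (a (gi0 s))) + _] := H x'.
      move=> t m tm; rewrite /x' /x0; case: eqS => // _.
      by apply/Nat.leb_gt.
    rewrite /tau /x'; case: eqS => // _; case: eqS => // _.
    by move=> /Nat.leb_gt; lia.
  - exists F => s; apply: NNPP => nF.
    have [g [gi [a [b [_ [[_ H] abF]]]]]] := tameSV _ (SV_flip Ggrp s) x0.
    have [_ bs] := abF s nF.
    (* Since [b s = 0], the germ makes the first bit of the image at [s] a bit of [x0], hence 0, but
       the flip made it 1. *)
    have [//|/(_ s 0) + _] := H x0.
    by rewrite bs /flip cons_at_head.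
Qed.

End Necessity.

Theorem theoremA (S : Type) (G : (S -> S) -> Prop) :
  inhabited S -> is_perm_subgroup G ->
  (fin_gen (SV G) <-> (fin_gen G /\ finitely_many_orbits G)).
Proof.
  move=> S0 Ggrp; split; first exact: fin_gen_SV_inv.
  by case; apply: fin_gen_SV.
Qed.
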